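(* Let $(h_n)_{n\ge0}$ be a non-increasing sequence of positive real numbers and let $(x_n)_{n\ge0}$ be the solution of $x_{n+1}=x_n(1-h_nx_n^2)$, $n=0,1,2,\dots$, with initial value $x_0\in\mathbb R$, $x_0\ne0$. Suppose that there exists $N\in\mathbb N$ such that $h_Nx_N^2<1$, and that $\sum_{j=1}^\infty h_j=S<\infty$. Then $\lim_{n\to\infty}x_n=L\neq0$.
   Formalization: The N with h_N x_N^2 < 1 is also required to satisfy x_N ≠ 0, since otherwise the claim fails: h_n = 2^{-n}, x_0 = 1 gives x_n = 0 for all n ≥ 1, so h_1 x_1^2 = 0 < 1 but the limit is 0. *)

(* Defs.v *)
From HB Require Import structures.
From mathcomp Require Import all_boot all_order all_algebra.
From mathcomp Require Import all_classical all_reals all_analysis.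

Set Implicit Arguments.
Unset Strict Implicit.
Unset Printing Implicit Defensive.

(* Main.v *)
Require Import Defs.
From HB Require Import structures.
From mathcomp Require Import all_boot all_order all_algebra.
From mathcomp Require Import all_classical all_reals all_analysis.
From mathcomp Require Import lra.
Import Order.TTheory GRing.Theory Num.Theory.
Import numFieldNormedType.Exports.
Local Open Scope classical_set_scope.
Local Open Scope ring_scope.

(** Put [u n = h n * x n ^+ 2], so that the recursion reads
    [x n.+1 = x n * (1 - u n)].  Once some [u N] lies below [1], the factor
    [1 - u N] lies in [[0, 1]], hence [x n ^+ 2] does not increase at that step;
    as [h] does not increase either, [u N.+1 <= u N], and the situation
    perpetuates itself ([damping_persists]).

    From [N] on, therefore, [x (N + k)] is [x N] times a partial product of the
    infinite product of the [1 - u (N + i)].  Its terms satisfy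
    [0 <= u (N + i) <= u N < 1], and they are summable because
    [u (N + i) <= h (N + i) * x N ^+ 2].  Such a product has a positive limit
    ([cvg_prod1B]): the partial products are nonincreasing, and comparing each
    factor with an exponential keeps them away from [0]. *)

(** With [q < 1], the graph of [1 - u] on [[0, q]] lies above a decaying
    exponential: with [t = u / (1 - q)], the product [(1 - u) * (1 + t)] exceeds
    [1] by [t * (q - u) >= 0], and [1 + t <= expR t]. *)
Lemma expRN_le1B (R : realType) (q u : R) :
  q < 1 -> 0 <= u <= q -> expR (- (u / (1 - q))) <= 1 - u.
Proof.
move=> q1 /andP[u0 uq].
have c0 : 0 < 1 - q by rewrite subr_gt0.
set t := u / (1 - q).
have t0 : 0 <= t by rewrite divr_ge0// ltW.
have ut : u = t * (1 - q) by rewrite divfK// gt_eqF.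
rewrite expRN -[leLHS]mul1r ler_pdivrMr ?expR_gt0//.
apply: (@le_trans _ _ ((1 - u) * (1 + t))); last first.
  by rewrite ler_wpM2l ?expR_ge1Dx// subr_ge0 (le_trans uq)// ltW.
have -> : (1 - u) * (1 + t) = 1 + t * (q - u) by clearbody t; lra.
by rewrite lerDl mulr_ge0// subr_ge0.
Qed.

Lemma expRN_sum_le_prod1B (R : realType) (q : R) (u : nat -> R) (n : nat) :
  q < 1 -> (forall k, 0 <= u k <= q) ->
  expR (- ((\sum_(0 <= k < n) u k) / (1 - q))) <= \prod_(0 <= k < n) (1 - u k).
Proof.
move=> q1 uq; elim: n => [|n IHn]; first by rewrite !big_geq// mul0r oppr0 expR0.
rewrite !big_nat_recr//= mulrDl opprD expRD.
by apply: ler_pM; rewrite ?expR_ge0//; exact: expRN_le1B.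
Qed.

(** A product of factors [1 - u k] with summable [u k] in [[0, q]], [q < 1],
    does not diverge to [0]: its partial products are nonincreasing, and a bound
    [M] on the partial sums keeps them above [expR (- (M / (1 - q)))]. *)
Lemma cvg_prod1B (R : realType) (q M : R) (u : nat -> R) :
  q < 1 -> (forall k, 0 <= u k <= q) ->
  (forall n, \sum_(0 <= k < n) u k <= M) ->
  exists2 l : R, 0 < l & \prod_(0 <= k < n) (1 - u k) @[n --> \oo] --> l.
Proof.
move=> q1 uq uM; set p := fun n => \prod_(0 <= k < n) (1 - u k).
have c0 : 0 < 1 - q by rewrite subr_gt0.
have p_ge n : expR (- (M / (1 - q))) <= p n.
  apply: le_trans (expRN_sum_le_prod1B _ _ _ n q1 uq).
  by rewrite ler_expR lerN2 ler_pM2r ?invr_gt0.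
have p_noninc : nonincreasing_seq p.
  apply/nonincreasing_seqP => n; rewrite /p big_nat_recr//= ler_piMr//.
    exact: le_trans (expR_ge0 _) (p_ge n).
  by rewrite gerBl; case/andP: (uq n).
have p_cvg : cvgn p.
  apply: nonincreasing_is_cvgn p_noninc _.
  by exists (expR (- (M / (1 - q)))) => _ [n _ <-].
exists (limn p) => //.
apply: lt_le_trans (expR_gt0 _) (limr_ge p_cvg _).
by apply: nearW; exact: p_ge.
Qed.

(** Both bounds are proved together: a step cannot increase [x n ^+ 2] as long as
    [h n * x n ^+ 2 <= 1], and this last bound survives because neither of its
    factors increases. *)
Lemma damping_persists (R : realType) (h x : nat -> R) (N : nat) :
  (forall n, 0 <= h n) -> nonincreasing_seq h ->
  (forall n, x n.+1 = x n * (1 - h n * x n ^+ 2)) ->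
  h N * x N ^+ 2 <= 1 ->
  forall k, x (N + k)%N ^+ 2 <= x N ^+ 2 /\
            h (N + k)%N * x (N + k)%N ^+ 2 <= h N * x N ^+ 2.
Proof.
move=> h0 h_noninc x_rec uN1; elim=> [|k [IHx IHu]]; first by rewrite addn0.
rewrite addnS; set n := (N + k)%N in IHx IHu *.
have xS : x n.+1 ^+ 2 <= x n ^+ 2.
  have u0 : 0 <= h n * x n ^+ 2 by rewrite mulr_ge0// sqr_ge0.
  rewrite x_rec exprMn ler_piMr ?sqr_ge0// expr_le1//.
    by rewrite gerBl.
  by rewrite subr_ge0 (le_trans IHu).
split; first exact: le_trans xS IHx.
apply: le_trans IHu; apply: ler_pM; rewrite ?sqr_ge0//.
by apply: h_noninc.
Qed.

(** The term [h 0] accounts for the case [N = 0], since the series that sums to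
    [S] starts at index [1]. *)
Lemma sum_shift_le (R : realType) (h : nat -> R) (S : R) (N n : nat) :
  (forall n, 0 <= h n) ->
  \sum_(1 <= j < n) h j @[n --> \oo] --> S ->
  \sum_(0 <= k < n) h (N + k)%N <= h 0%N + S.
Proof.
move=> h0 h_sum.
have s_nondec : nondecreasing_seq (fun n => \sum_(1 <= j < n) h j).
  apply/nondecreasing_seqP => -[|m]; first by rewrite !big_geq.
  by rewrite [leRHS]big_nat_recr//= lerDl.
have s_le m : \sum_(1 <= j < m) h j <= S.
  rewrite -(cvg_lim _ h_sum)//; apply: (nondecreasing_cvgn_le s_nondec).
  by apply/cvg_ex; exists S.
have -> : \sum_(0 <= k < n) h (N + k)%N = \sum_(N <= j < N + n) h j.
  rewrite -[in RHS](add0n N) [in RHS]big_addn addnC addnK.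
  by apply: eq_bigr => k _; rewrite addnC.
apply: (@le_trans _ _ (\sum_(0 <= j < (N + n).+1) h j)).
  have -> : \sum_(0 <= j < (N + n).+1) h j =
      \sum_(0 <= j < N) h j + \sum_(N <= j < N + n) h j + h (N + n)%N.
    by rewrite big_nat_recr//= -big_cat_nat//= leq_addr.
  by rewrite addrAC lerDr addr_ge0// sumr_ge0.
by rewrite big_nat_recl//= lerD2l; have := s_le (N + n).+1; rewrite big_add1.
Qed.

Theorem lemma8 (R : realType) (h x : nat -> R) (S : R)
  (h_pos : forall n, 0 < h n)
  (h_noninc : nonincreasing_seq h)
  (x_rec : forall n, x n.+1 = x n * (1 - h n * x n ^+ 2))
  (x0_neq0 : x 0%N != 0)
  (hN : exists N : nat, x N != 0 /\ h N * x N ^+ 2 < 1)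
  (h_sum : \sum_(1 <= j < n) h j @[n --> \oo] --> S) :
  exists L : R, x n @[n --> \oo] --> L /\ L != 0.
Proof.
case: hN => N [xN0 uN1].
have h0 n : 0 <= h n by exact: ltW.
pose u k := h (N + k)%N * x (N + k)%N ^+ 2.
have damped := @damping_persists R h x N h0 h_noninc x_rec (ltW uN1).
have u_bounds k : 0 <= u k <= h N * x N ^+ 2.
  by rewrite mulr_ge0 ?sqr_ge0//=; case: (damped k).
have u_sum n : \sum_(0 <= k < n) u k <= (h 0%N + S) * x N ^+ 2.
  apply: (@le_trans _ _ ((\sum_(0 <= k < n) h (N + k)%N) * x N ^+ 2)).
    rewrite mulr_suml; apply: ler_sum => k _.
    by rewrite ler_wpM2l//; case: (damped k).
  by rewrite ler_wpM2r ?sqr_ge0//; exact: sum_shift_le.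
have [l l0 p_cvg] := cvg_prod1B _ _ _ _ uN1 u_bounds u_sum.
exists (x N * l); split; last by rewrite mulf_neq0// gt_eqF.
have xE k : x (k + N)%N = x N * \prod_(0 <= i < k) (1 - u i).
  elim: k => [|k IHk]; first by rewrite big_geq// mulr1.
  by rewrite big_nat_recr// mulrA -IHk addSn x_rec /u addnC.
rewrite -(cvg_shiftn N).
under eq_fun do rewrite xE.
exact: cvgMr p_cvg.
Qed.
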